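(* Let $p\ge5$ be a prime. The Vieta graph of the cubic $x^2+y^2+z^2=xyz+D$ over $\mathbb{F}_p$ satisfies the following. (a) If $D=0$: there are $p^2+1+3\sigma(-1)p$ vertices in total, of which $3p-11-3\sigma(-1)$ are deficient; there are $3\big(p-4-\sigma(-1)\big)$ vertices of degree $2$, $0$ of degree $1$, and $1$ of degree $0$. (b) If $D=-4$: there are $p^2+1+\big(3+\sigma(-1)\big)\sigma(-2)p$ vertices in total, of which $3\big(p-4-\sigma(-1)+\sigma(-2)\varphi_2(1)\big)$ are deficient; there are $3\big(p-5-2\sigma(-1)+\sigma(-2)\varphi_2(1)\big)$ vertices of degree $2$, $3\big(1+\sigma(-1)\big)$ of degree $1$, and $0$ of degree $0$. (c) If $D=2$: there are $p^2+1+\big(3+\sigma(2)\big)\sigma(-2)p$ vertices in total, of which $3\big(p-4-\sigma(2)+\varphi_2(1)\big)$ are deficient; there are $3\big(p-5-2\sigma(2)+\varphi_2(1)\big)$ vertices of degree $2$, $3\big(1+\sigma(2)\big)$ of degree $1$, and $0$ of degree $0$. (d) If $D=8$: there are $p^2+1+\big(3+\sigma(2)\big)p$ vertices in total, of which $3\big(p-4-\sigma(2)+\sigma(2)\varphi_2(1)\big)$ are deficient; there are $3\big(p-5-2\sigma(2)+\sigma(2)\varphi_2(1)\big)$ vertices of degree $2$, $3\big(1+\sigma(2)\big)$ of degree $1$, and $0$ of degree $0$.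
   Context: $\sigma:\mathbb{F}_p\to\{-1,0,1\}\subset\mathbb{Z}$ denotes the quadratic character: $\sigma(a)=1$ if $a$ is a nonzero square, $\sigma(a)=-1$ if $a$ is a non-square, $\sigma(0)=0$. The Jacobsthal sum is $\varphi_2(1)=\sum_{x\in\mathbb{F}_p}\sigma(x^3+x)$. The Vieta graph of the equation $x^2+y^2+z^2=xyz+D$ over $\mathbb{F}_p$ is the finite simple graph whose vertices are the solutions $(x,y,z)\in\mathbb{F}_p^3$, where two distinct vertices are joined by an edge whenever one is a Vieta flip of the other. The Vieta flips of $(x,y,z)$ are $(yz-x,y,z)$, $(x,xz-y,z)$, $(x,y,xy-z)$. Every vertex has degree at most $3$; a vertex is deficient if its degree is less than $3$. *)

(* Defs.v *)
From HB Require Import structures.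
From mathcomp Require Import all_boot all_order all_algebra.

Set Implicit Arguments.
Unset Strict Implicit.
Unset Printing Implicit Defensive.

Import GRing.Theory.
Local Open Scope ring_scope.

(* The quadratic character, with values in the integers. *)
Definition quadchar (F : finFieldType) (a : F) : int :=
  if a == 0 then 0 else if [exists b : F, b ^+ 2 == a] then 1 else -1.

(* The value at 1 of the Jacobsthal sum phi_2. *)
Definition jacobsthal2_1 (F : finFieldType) : int :=
  \sum_(x : F) quadchar (x ^+ 3 + x).

Definition vieta_vertices (F : finFieldType) (D : F) : {set F * F * F} :=
  [set v | let: (x, y, z) := v in
           x ^+ 2 + y ^+ 2 + z ^+ 2 == x * y * z + D].

Definition vieta_flips (F : finFieldType) (v : F * F * F) : seq (F * F * F) :=
  let: (x, y, z) := v in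
  [:: (y * z - x, y, z); (x, x * z - y, z); (x, y, x * y - z)].

(* Adjacency is false outside the vertex set; a flip that fixes a vertex
   contributes no edge. *)
Definition vieta_edge (F : finFieldType) (D : F) : rel (F * F * F) :=
  fun v w => [&& v \in vieta_vertices D, w \in vieta_vertices D, v != w
               & (w \in vieta_flips v) || (v \in vieta_flips w)].

Definition vieta_degree (F : finFieldType) (D : F) (v : F * F * F) : nat :=
  #|[set w | vieta_edge D v w]|.

Definition vieta_deficient (F : finFieldType) (D : F) : {set F * F * F} :=
  [set v in vieta_vertices D | (vieta_degree D v < 3)%N].

Definition vieta_degree_eq (F : finFieldType) (D : F) (d : nat) :
    {set F * F * F} :=
  [set v in vieta_vertices D | vieta_degree D v == d].

(* Main.v *)
Require Import Defs.
From mathcomp Require Import all_boot all_order all_algebra.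
From mathcomp Require Import ring zify.

(* The flip of a coordinate fixes a vertex iff that coordinate is half the
   product of the other two, so the degree counts reduce to the numbers of
   vertices fixed by one, two and three flips.  Two flips fix only the points
   (0, 0, z) with z^2 = D (here D != 4 is used); one flip fixes the points of a
   curve (y^2 - 4) z^2 = 4 (y^2 - D), whose point count is the character sum of
   (y^2 - 4) (y^2 - D), and substituting t = y^2 turns it into the sum of
   t (t - 4) (t - D).  For D = -4, 2, 8 the three roots are in arithmetic
   progression, hence an affine change of variable gives a multiple of
   t^3 - t, and t -> i t with i^2 = -1 (or oddness, if -1 is a non-square)
   gives the Jacobsthal sum.  Vertices are counted by solving the quadratic in
   z and summing its discriminant, which is quadratic in y for fixed x. *)

Local Open Scope ring_scope.
Import Order.TTheory GRing.Theory Num.Theory.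

(** * Counting by integer sums of indicators *)

Lemma sum_indicator_eq (T : finType) (a : T) :
  \sum_(x : T) (x == a)%:Z = 1.
Proof.
rewrite (bigD1 a) //= eqxx big1 ?addr0 // => x /negbTE -> //.
Qed.

Lemma card_sum_indicator (T : finType) (P : pred T) :
  #|[set x | P x]|%:Z = \sum_(x : T) (P x)%:Z.
Proof.
rewrite -sum1dep_card big_mkcond /= -[LHS]natz natr_sum.
by apply: eq_bigr => x _; case: (P x).
Qed.

Lemma sum_triple (T : finType) (G : T * T * T -> int) :
  \sum_(v : T * T * T) G v = \sum_(x : T) \sum_(y : T) \sum_(z : T) G (x, y, z).
Proof.
rewrite pair_bigA /= pair_bigA /=.
by apply: eq_bigr => [[[x y] z]] _.
Qed.

(** * The quadratic character in odd characteristic *)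

Section QuadraticCharacter.

Variable F : finFieldType.
Hypothesis two_neq0 : 2 != 0 :> F.
Implicit Types a b c x y z t : F.
Local Notation s := (@quadchar F).
Local Notation q := (#|F|%:Z).

Lemma quadchar0 : s 0 = 0.
Proof. by rewrite /quadchar eqxx. Qed.

Lemma quadchar_sqr a : a != 0 -> s (a ^+ 2) = 1.
Proof.
move=> a0; rewrite /quadchar expf_eq0 /= (negbTE a0).
by case: existsP => // -[]; exists a.
Qed.

Lemma quadchar4 : s 4 = 1.
Proof. by rewrite (_ : 4 = 2 ^+ 2) ?quadchar_sqr //; ring. Qed.

Lemma four_neq0 : 4 != 0 :> F.
Proof. by rewrite (_ : 4 = 2 * 2 :> F) ?mulf_neq0 //; ring. Qed.

Lemma neq_opp a : a != 0 -> (a == - a) = false.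
Proof.
move=> a0; apply/negP; rewrite -subr_eq0 opprK -mulr2n -mulr_natl mulf_eq0.
by rewrite (negbTE two_neq0) (negbTE a0).
Qed.

Lemma sum_sqrt a : \sum_(x : F) (x ^+ 2 == a)%:Z = 1 + s a.
Proof.
rewrite /quadchar; case: eqP => [->|/eqP a0].
  rewrite addr0 -(@sum_indicator_eq F 0).
  by apply: eq_bigr => x _; rewrite expf_eq0.
case: existsP => [[b /eqP ab]|nsq]; last first.
  rewrite big1 ?subrr // => x _; case: eqP => // xa.
  by case: nsq; exists x; apply/eqP.
have b0 : b != 0 by apply: contra a0 => /eqP b0; rewrite -ab b0 expr0n.
rewrite -{1}(@sum_indicator_eq F b) -(@sum_indicator_eq F (- b)) -big_split /=.
apply: eq_bigr => x _; rewrite -ab eqf_sqr.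
by case: eqP => [->|]; rewrite ?neq_opp //=; case: eqP.
Qed.

Lemma sum_const_int (n : int) : \sum_(x : F) n = q * n.
Proof. by rewrite sumr_const -mulr_natl natz. Qed.

(** Count the pairs (a, x) with x^2 = a twice: by x there are q of them, by a there are q plus this
    sum. *)
Lemma sum_quadchar : \sum_(x : F) s x = 0.
Proof.
have : \sum_(a : F) \sum_(x : F) (x ^+ 2 == a)%:Z = q.
  rewrite exchange_big /= -[RHS]mulr1 -sum_const_int.
  apply: eq_bigr => x _; rewrite -[RHS](@sum_indicator_eq F (x ^+ 2)).
  by apply: eq_bigr => a _; rewrite eq_sym.
under eq_bigr => a _ do rewrite sum_sqrt.
by rewrite big_split /= sum_const_int mulr1 => /(canRL (addKr _)) ->; rewrite addNr.
Qed.

Lemma quadcharP a :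
  [\/ a = 0 /\ s a = 0, (exists2 b, b != 0 & a = b ^+ 2) /\ s a = 1
    | a != 0 /\ s a = -1].
Proof.
rewrite /quadchar; case: eqP => [->|/eqP a0]; first by apply: Or31.
case: existsP => [[b /eqP ab]|_]; last exact: Or33.
apply: Or32; split=> //; exists b => //.
by apply: contra a0 => /eqP b0; rewrite -ab b0 expr0n.
Qed.

Lemma quadcharMsq a b : b != 0 -> s (b ^+ 2 * a) = s a.
Proof.
move=> b0; rewrite /quadchar mulf_eq0 expf_eq0 /= (negbTE b0) /=.
case: eqP => // _; congr (if _ then _ else _).
apply/existsP/existsP => -[x /eqP e].
  by exists (x / b); rewrite expr_div_n e mulrAC divff ?mul1r ?expf_neq0.
by exists (b * x); rewrite exprMn e.
Qed.

(* If [a] is a non-square, the terms of [\sum_b (s (a * b) + s b) = 0] are all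
   nonpositive, hence all zero. *)
Lemma quadcharM a b : s (a * b) = s a * s b.
Proof.
case: (quadcharP a) => [[-> _]|[[c c0 ->] _]|[a0 sa]].
- by rewrite mul0r quadchar0 mul0r.
- by rewrite quadcharMsq ?quadchar_sqr ?mul1r.
have sum0 : \sum_(b : F) - (s (a * b) + s b) = 0.
  rewrite sumrN big_split /= sum_quadchar.
  have bij : bijective ( *%R a).
    by exists ( *%R a^-1) => x; rewrite ?mulKf ?mulVKf.
  by rewrite addr0 -[in RHS]oppr0 -[in RHS]sum_quadchar [in RHS](reindex _ (onW_bij _ bij)).
have ge0 x : 0 <= - (s (a * x) + s x).
  case: (quadcharP x) => [[-> _]|[[c c0 ->] _]|[x0 sx]].
  - by rewrite mulr0 quadchar0.
  - by rewrite mulrC quadcharMsq // quadchar_sqr // sa.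
  - by rewrite sx; case: (quadcharP (a * x)) => -[_ ->].
have := psumr_eq0P (fun x _ => ge0 x) sum0 => /(_ b isT).
rewrite sa; lia.
Qed.

Lemma quadchar_mul_self a : a != 0 -> s a * s a = 1.
Proof. by move=> a0; rewrite -quadcharM -expr2 quadchar_sqr. Qed.

(** * Root counts and character sums of quadratic polynomials *)

Lemma sum_sqrt_lin a c : a != 0 ->
  \sum_(x : F) (a * x ^+ 2 == c)%:Z = 1 + s (a * c).
Proof.
move=> a0; have -> : a * c = a ^+ 2 * (c / a) by field.
rewrite quadcharMsq // -sum_sqrt; apply: eq_bigr => x _.
by rewrite -[in RHS](inj_eq (mulfI a0)) (_ : a * (c / a) = c) //; field.
Qed.

Lemma sum_quadratic_roots b c :
  \sum_(x : F) (x ^+ 2 - b * x + c == 0)%:Z = 1 + s (b ^+ 2 - 4 * c).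
Proof.
(* Completing the square: in the new variable, four times the equation says that its square is the
   discriminant. *)
have bij : bijective (fun x => (x + b) / 2).
  by exists (fun y => 2 * y - b) => x; field.
rewrite (reindex _ (onW_bij _ bij)) /= -sum_sqrt; apply: eq_bigr => x _.
rewrite -[in RHS]subr_eq0.
rewrite -[in LHS](inj_eq (mulfI four_neq0)) mulr0.
by congr ((_ == 0)%:Z); field.
Qed.

(** The sum is read off from the point count of the hyperbola w^2 = y^2 + c. With u = w + y the
    equation is linear in y, namely 2uy = u^2 - c: one point for each u != 0, and none for u = 0
    because c != 0. *)
Lemma sum_quadchar_sqr_add c : c != 0 -> \sum_(y : F) s (y ^+ 2 + c) = -1.
Proof.
move=> c0.
have : \sum_(y : F) \sum_(w : F) (w ^+ 2 == y ^+ 2 + c)%:Z = q - 1.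
  transitivity (\sum_(y : F) \sum_(u : F) (2 * u * y == u ^+ 2 - c)%:Z).
    apply: eq_bigr => y _.
    have bij : bijective (fun u => u - y).
      by exists (fun w => w + y) => x; ring.
    rewrite (reindex _ (onW_bij _ bij)) /=; apply: eq_bigr => u _.
    rewrite -subr_eq0 -[in RHS]subr_eq0 -[in RHS]oppr_eq0.
    by congr ((_ == 0)%:Z); ring.
  rewrite exchange_big /= (bigD1 0) //= big1 ?add0r; last first.
    move=> y _; rewrite mulr0 mul0r expr0n /= sub0r eq_sym oppr_eq0.
    by rewrite (negbTE c0).
  rewrite -[q]mulr1 -sum_const_int [in RHS](bigD1 0) //= addrC addrK.
  apply: eq_bigr => u u0; rewrite -[RHS](@sum_indicator_eq F ((u ^+ 2 - c) / (2 * u))).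
  apply: eq_bigr => y _; have u20 : 2 * u != 0 by rewrite mulf_neq0.
  by rewrite -[in RHS](inj_eq (mulfI u20)) [X in _ = (_ == X)%:Z]mulrC divfK.
under eq_bigr => a _ do rewrite sum_sqrt.
by rewrite big_split /= sum_const_int mulr1 => /(canRL (addKr _)) ->; rewrite addrA addNr.
Qed.

Lemma sum_quadchar_quadratic a c : a != 0 ->
  \sum_(y : F) s (a * y ^+ 2 + c) = q * (s a * (c == 0)%:Z) - s a.
Proof.
move=> a0.
have -> : \sum_(y : F) s (a * y ^+ 2 + c) = s a * \sum_(y : F) s (y ^+ 2 + c / a).
  rewrite mulr_sumr; apply: eq_bigr => y _; rewrite -quadcharM.
  by congr s; field.
case: eqP => [->|/eqP c0]; last first.
  by rewrite sum_quadchar_sqr_add ?mulf_neq0 ?invr_eq0 // !mulr0 mulrN1 add0r.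
rewrite mul0r (bigD1 0) //= addr0 expr0n /= quadchar0 add0r.
have -> : \sum_(y | y != 0) s (y ^+ 2 + 0) = q - 1.
  rewrite -[q]mulr1 -sum_const_int [in RHS](bigD1 0) //= [1 + _]addrC addrK.
  by apply: eq_bigr => y y0; rewrite addr0 quadchar_sqr.
by rewrite mulr1; ring.
Qed.

(** * Character sums of a quartic in y^2 and of odd cubics *)

Lemma sum_comp_sqr (g : F -> int) :
  \sum_(y : F) g (y ^+ 2) = \sum_(t : F) g t * (1 + s t).
Proof.
transitivity (\sum_(y : F) \sum_(t : F) g t * (y ^+ 2 == t)%:Z).
  apply: eq_bigr => y _; rewrite (bigD1 (y ^+ 2)) //= eqxx mulr1 big1 ?addr0 //.
  by move=> t; rewrite eq_sym => /negbTE ->; rewrite mulr0.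
rewrite exchange_big /=; apply: eq_bigr => t _.
by rewrite -mulr_sumr sum_sqrt.
Qed.

Lemma sum_quadchar_quartic D : D != 4 ->
  \sum_(y : F) s ((y ^+ 2 - 4) * (y ^+ 2 - D)) =
  -1 + \sum_(t : F) s (t * (t - 4) * (t - D)).
Proof.
move=> D4; rewrite (sum_comp_sqr (fun t => s ((t - 4) * (t - D)))).
under eq_bigr => t _ do rewrite mulrDr mulr1 -quadcharM [_ * t]mulrC mulrA.
rewrite big_split /=; congr (_ + _).
(* Centring at the midpoint of the roots 4 and D leaves r^2 minus a constant that is nonzero because
   D != 4. *)
have bij : bijective (fun r => r + (4 + D) / 2).
  by exists (fun t => t - (4 + D) / 2) => x; ring.
rewrite (reindex _ (onW_bij _ bij)) /=.
rewrite -(@sum_quadchar_sqr_add (- ((4 - D) / 2) ^+ 2)).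
  by apply: eq_bigr => r _; congr s; field.
by rewrite oppr_eq0 expf_eq0 /= mulf_neq0 ?invr_eq0 // subr_eq0 eq_sym.
Qed.

(** The substitution x -> -x turns the sum into its own negative. *)
Lemma sum_quadchar_odd (g : F -> F) : s (-1) = -1 -> {morph g : x / - x} ->
  \sum_(x : F) s (g x) = 0.
Proof.
move=> sN1 gN; have bij : bijective (@GRing.opp F).
  by exists (@GRing.opp F); apply: opprK.
have : \sum_(x : F) s (g x) = - \sum_(x : F) s (g x).
  rewrite {1}(reindex _ (onW_bij _ bij)) /= -sumrN; apply: eq_bigr => x _.
  by rewrite gN -mulN1r quadcharM sN1 mulN1r.
lia.
Qed.

Lemma sum_quadchar_cube_sub :
  \sum_(x : F) s (x ^+ 3 - x) = s (-2) * jacobsthal2_1 F.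
Proof.
rewrite /jacobsthal2_1.
case: (quadcharP (-1)) => [[/eqP]|[[i i0 iN1] _]|[_ sN1]].
- by rewrite oppr_eq0 oner_eq0.
- have bij : bijective ( *%R i).
    by exists ( *%R i^-1) => x; rewrite ?mulKf ?mulVKf.
  rewrite [in RHS](reindex _ (onW_bij _ bij)) /= mulr_sumr.
  apply: eq_bigr => x _; rewrite -quadcharM.
  (* Putting i x into x^3 + x gives -i (x^3 - x); together with the factor -2 this is 2i (x^3 - x),
     and 2i = (1 + i)^2 is a nonzero square. *)
  have i1 : 1 + i != 0.
    apply: contraNneq two_neq0 => i1; have iE : i = -1 by rewrite -[i](addKr 1) i1 addr0.
    by move: iN1; rewrite iE sqrrN expr1n => /eqP; rewrite eq_sym -addr_eq0.
  rewrite -(quadcharMsq (x ^+ 3 - x) _ i1); congr s.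
  rewrite [X in _ = X](_ : _ = -2 * i * (i ^+ 2 * x ^+ 3 + x)); last by ring.
  by rewrite sqrrD -iN1; ring.
by rewrite !sum_quadchar_odd ?mulr0 // => x; ring.
Qed.

Lemma sum_quadchar_sqr_sub4 : \sum_(x : F) s (x ^+ 2 - 4) = -1.
Proof. by rewrite sum_quadchar_sqr_add // oppr_eq0 four_neq0. Qed.

(** Each flip is an involution, since yz - (yz - x) = x. *)
Lemma vieta_flips_sym (v w : F * F * F) :
  (v \in vieta_flips w) = (w \in vieta_flips v).
Proof.
have imp (v' w' : F * F * F) : v' \in vieta_flips w' -> w' \in vieta_flips v'.
  case: v' w' => [[x y] z] [[x' y'] z']; rewrite !inE !xpair_eqE.
  by case/or3P => /andP[/andP[/eqP-> /eqP->] /eqP->]; rewrite subKr !eqxx ?orbT.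
by apply/idP/idP; apply: imp.
Qed.

(** * Counting vertices and vertices fixed by flips, for D != 4 *)

Section FixedD.

Variable D : F.
Hypothesis D_neq4 : D != 4.

Local Notation vtx x y z := (x ^+ 2 + y ^+ 2 + z ^+ 2 == x * y * z + D).

(** For fixed x the discriminant in z is (x^2 - 4) y^2 - 4 (x^2 - D). It contributes an extra q s(D
    - 4) when its leading or its constant coefficient vanishes, that is for the 2 roots of x^2 = 4
    and the 1 + s(D) roots of x^2 = D; hence the factor 3 + s(D). *)
Lemma sum_vertices :
  \sum_(x : F) \sum_(y : F) \sum_(z : F) (vtx x y z)%:Z =
  q ^+ 2 + 1 + (3 + s D) * s (D - 4) * q.
Proof.
have line x : \sum_(y : F) \sum_(z : F) (vtx x y z)%:Z =
    q + (q * s (D - 4) * (x ^+ 2 == 4)%:Z + q * s (D - 4) * (x ^+ 2 == D)%:Z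
         - s (x ^+ 2 - 4)).
  transitivity (\sum_(y : F) (1 + s ((x ^+ 2 - 4) * y ^+ 2 + - 4 * (x ^+ 2 - D)))).
    apply: eq_bigr => y _.
    have -> : (x ^+ 2 - 4) * y ^+ 2 + - 4 * (x ^+ 2 - D) =
              (x * y) ^+ 2 - 4 * (x ^+ 2 + y ^+ 2 - D) by ring.
    rewrite -sum_quadratic_roots; apply: eq_bigr => z _; rewrite -subr_eq0.
    by congr ((_ == 0)%:Z); ring.
  rewrite big_split /= sum_const_int mulr1; congr (_ + _).
  case: (eqVneq (x ^+ 2) 4) => [->|x4].
    rewrite subrr eq_sym (negbTE D_neq4) quadchar0 /=.
    under eq_bigr => y _ do rewrite mul0r add0r.
    rewrite sum_const_int (_ : -4 * (4 - D) = 2 ^+ 2 * (D - 4)); last by ring.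
    by rewrite quadcharMsq //; ring.
  rewrite sum_quadchar_quadratic ?subr_eq0 // mulf_eq0 oppr_eq0.
  rewrite (negbTE four_neq0) subr_eq0 /=.
  by case: eqP => [->|_] /=; ring.
under eq_bigr => x _ do rewrite line.
rewrite !big_split /= sumrN sum_const_int -!mulr_sumr !sum_sqrt.
rewrite sum_quadchar_sqr_sub4 quadchar4; ring.
Qed.

Lemma sum_fixed1 :
  \sum_(x : F) \sum_(y : F) \sum_(z : F) (vtx x y z && (y * z - x == x))%:Z =
  q - 3 + \sum_(t : F) s (t * (t - 4) * (t - D)).
Proof.
rewrite exchange_big /=.
have line y : \sum_(x : F) \sum_(z : F) (vtx x y z && (y * z - x == x))%:Z =
    1 - (y ^+ 2 == 4)%:Z + s ((y ^+ 2 - 4) * (y ^+ 2 - D)).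
  rewrite exchange_big /=.
  transitivity (\sum_(z : F) ((y ^+ 2 - 4) * z ^+ 2 == 2 ^+ 2 * (y ^+ 2 - D))%:Z).
    apply: eq_bigr => z _.
    have fixE x : (y * z - x == x) = (x == y * z / 2).
      rewrite -subr_eq0 -[in RHS]subr_eq0 -[in RHS](inj_eq (mulfI two_neq0)) mulr0.
      by rewrite -[in RHS]oppr_eq0; congr (_ == 0); field.
    (* Only x = yz/2 is fixed by the flip; substituting it and multiplying by 4 gives the curve in y
       and z. *)
    rewrite (bigD1 (y * z / 2)) //= big1 ?addr0; last first.
      by move=> x xyz; rewrite fixE (negbTE xyz) andbF.
    rewrite fixE eqxx andbT -subr_eq0 -[in LHS](inj_eq (mulfI four_neq0)) mulr0.
    by rewrite -[in LHS]oppr_eq0 -[in RHS]subr_eq0; congr ((_ == 0)%:Z); field.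
  (* For y^2 = 4 the curve has no point, since D != 4. These two values of y and the -1 from the
     quartic sum make up the constant -3. *)
  case: (eqVneq (y ^+ 2) 4) => [->|y4].
    rewrite subrr mul0r quadchar0 big1 // => z _; rewrite mul0r eq_sym.
    by rewrite mulf_eq0 expf_eq0 /= (negbTE two_neq0) subr_eq0 eq_sym (negbTE D_neq4).
  rewrite sum_sqrt_lin ?subr_eq0 // mulrCA quadcharMsq //= subr0 //.
under eq_bigr => y _ do rewrite line.
rewrite !big_split /= sumrN sum_const_int sum_sqrt quadchar4.
rewrite sum_quadchar_quartic //; ring.
Qed.

Lemma fixed12E x y z :
  [&& vtx x y z, y * z - x == x & x * z - y == y] =
  [&& x == 0, y == 0 & z ^+ 2 == D].
Proof.
apply/and3P/and3P => [[/eqP v /eqP fx /eqP fy]|[/eqP-> /eqP-> /eqP<-]]; last first.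
  by rewrite !mul0r !subr0 expr0n /= !add0r.
have fx2 : y * z = 2 * x by rewrite -[LHS](subrK x) fx; ring.
have fy2 : x * z = 2 * y by rewrite -[LHS](subrK y) fy; ring.
have x0 : x = 0.
  (* From yz = 2x and xz = 2y one gets x z^2 = 4x. If z^2 = 4, then x^2 = y^2 and xyz = 2x^2, so the
     cubic equation would force D = 4. *)
  have : x * (z ^+ 2 - 4) = 0.
    rewrite (_ : _ * _ = x * z * z - 4 * x); last by ring.
    by rewrite fy2 -mulrA fx2; ring.
  move/eqP; rewrite mulf_eq0 => /orP[/eqP //|/eqP z4].
  case/eqP: D_neq4; rewrite -[LHS](addKr (x * y * z)) -v.
  rewrite -mulrA fx2 (_ : z ^+ 2 = 4); last by rewrite -[LHS](subrK 4) z4 add0r.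
  have : 2 * (x ^+ 2 - y ^+ 2) = 0.
    rewrite (_ : _ * _ = x * (2 * x) - y * (2 * y)); last by ring.
    by rewrite -fx2 -fy2; ring.
  move/eqP; rewrite mulf_eq0 (negbTE two_neq0) subr_eq0 /= => /eqP <-; ring.
have y0 : y = 0.
  by apply/eqP; have /esym/eqP := fy2; rewrite x0 mul0r mulf_eq0 (negbTE two_neq0).
by move: v; rewrite x0 y0 !mul0r expr0n /= !add0r => ->.
Qed.

Lemma sum_fixed12 :
  \sum_(x : F) \sum_(y : F) \sum_(z : F)
     [&& vtx x y z, y * z - x == x & x * z - y == y]%:Z = 1 + s D.
Proof.
rewrite (bigD1 0) //= [X in _ + X]big1 ?addr0; last first.
  move=> x /negbTE x0; rewrite big1 // => y _; rewrite big1 // => z _.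
  by rewrite fixed12E x0.
rewrite (bigD1 0) //= [X in _ + X]big1 ?addr0; last first.
  by move=> y /negbTE y0; rewrite big1 // => z _; rewrite fixed12E y0 andbF.
by rewrite -sum_sqrt; apply: eq_bigr => z _; rewrite fixed12E !eqxx.
Qed.

(** On the points (0, 0, z) the third flip is z -> -z, so only the origin can be fixed by all three,
    and it is a vertex exactly when D = 0. *)
Lemma sum_fixed123 :
  \sum_(x : F) \sum_(y : F) \sum_(z : F)
     [&& vtx x y z, y * z - x == x, x * z - y == y & x * y - z == z]%:Z =
  (D == 0)%:Z.
Proof.
have fixE x y z :
    [&& vtx x y z, y * z - x == x, x * z - y == y & x * y - z == z] =
    [&& x == 0, y == 0, z == 0 & D == 0].
  transitivity ([&& x == 0, y == 0 & z ^+ 2 == D] && (x * y - z == z)).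
    by rewrite -fixed12E -!andbA.
  case: eqP => //= ->; case: eqP => //= ->.
  rewrite mul0r sub0r [- z == z]eq_sym.
  case: (eqVneq z 0) => [->|z0]; last by rewrite neq_opp ?andbF.
  by rewrite oppr0 expr0n eqxx andbT eq_sym.
rewrite (bigD1 0) //= [X in _ + X]big1 ?addr0; last first.
  move=> x /negbTE x0; rewrite big1 // => y _; rewrite big1 // => z _.
  by rewrite fixE x0.
rewrite (bigD1 0) //= [X in _ + X]big1 ?addr0; last first.
  by move=> y /negbTE y0; rewrite big1 // => z _; rewrite fixE y0 andbF.
rewrite (bigD1 0) //= [X in _ + X]big1 ?addr0; last first.
  by move=> z /negbTE z0; rewrite fixE z0 !andbF.
by rewrite fixE !eqxx.
Qed.

(** * From fixed flips to vertex degrees *)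

Lemma vieta_degreeE x y z : vtx x y z ->
  vieta_degree D (x, y, z) =
  ((y * z - x != x)%R + (x * z - y != y)%R + (x * y - z != z)%R)%N.
Proof.
move=> v; pose nb := [seq w <- vieta_flips (x, y, z) | w != (x, y, z)].
have vV : (x, y, z) \in vieta_vertices D by rewrite inE.
have flipV w : w \in vieta_flips (x, y, z) -> w \in vieta_vertices D.
  by rewrite !inE => /or3P[] /eqP-> /=; rewrite -subr_eq0;
    move: v; rewrite -subr_eq0 => /eqP v0; apply/eqP; rewrite -[RHS]v0; ring.
have edgeE w : vieta_edge D (x, y, z) w = (w \in nb).
  rewrite mem_filter /vieta_edge vV [(x, y, z) \in vieta_flips w]vieta_flips_sym orbb andTb eq_sym.
  case: eqP => [_|_]; first by rewrite andbF.
  by rewrite [~~ false]/= andTb andb_idl //; exact: flipV.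
have -> : vieta_degree D (x, y, z) = #|nb|.
  by rewrite /vieta_degree; apply: eq_card => w; rewrite inE edgeE.
(* Flips that move the vertex change different coordinates, so no two of them coincide. *)
have /card_uniqP -> : uniq nb.
  rewrite /nb /= !xpair_eqE !eqxx ?andbT /=.
  case e1: (y * z - x == x); case e2: (x * z - y == y);
    case e3: (x * y - z == z) => //=;
    rewrite !inE ?xpair_eqE ?[y == _]eq_sym ?[z == _]eq_sym ?e1 ?e2 ?e3;
    by rewrite ?andbF.
by rewrite size_filter /= !xpair_eqE !eqxx ?andbT /= addn0 addnA.
Qed.

Local Notation S P := (\sum_(x : F) \sum_(y : F) \sum_(z : F) (P x y z)%:Z).

Lemma sum3_swap12 (P : F -> F -> F -> bool) : S P = S (fun x y z => P y x z).
Proof. exact: exchange_big. Qed.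

Lemma sum3_swap23 (P : F -> F -> F -> bool) : S P = S (fun x y z => P x z y).
Proof. by apply: eq_bigr => x _; exact: exchange_big. Qed.

Lemma card_vieta_vertices : #|vieta_vertices D|%:Z = S (fun x y z => vtx x y z).
Proof. by rewrite card_sum_indicator sum_triple. Qed.

(* The indicator of "exactly [d] of three flips are not fixed" is a polynomial
   in the three indicators [e1], [e2], [e3] of "the flip is fixed"; the
   coordinate symmetry then leaves one sum per number of fixed flips. *)
Lemma card_vieta_degree_sym (Q : nat -> bool) (n0 n1 n2 n3 : int) :
  (forall e1 e2 e3 : bool, (Q (~~ e1 + ~~ e2 + ~~ e3)%N)%:Z =
     n0 + n1 * (e1%:Z + e2%:Z + e3%:Z)
     + n2 * ((e1 && e2)%:Z + (e1 && e3)%:Z + (e2 && e3)%:Z)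
     + n3 * [&& e1, e2 & e3]%:Z) ->
  #|[set v in vieta_vertices D | Q (vieta_degree D v)]|%:Z =
  n0 * S (fun x y z => vtx x y z)
  + 3 * n1 * S (fun x y z => vtx x y z && (y * z - x == x))
  + 3 * n2 * S (fun x y z => [&& vtx x y z, y * z - x == x & x * z - y == y])
  + n3 * S (fun x y z =>
      [&& vtx x y z, y * z - x == x, x * z - y == y & x * y - z == z]).
Proof.
move=> QE.
have vtx12 x y z : vtx y x z = vtx x y z by congr (_ == _); ring.
have vtx23 x y z : vtx x z y = vtx x y z by congr (_ == _); ring.
have s2 : S (fun x y z => vtx x y z && (x * z - y == y)) =
          S (fun x y z => vtx x y z && (y * z - x == x)).
  rewrite sum3_swap12; do 3!apply: eq_bigr => ? _; by rewrite vtx12.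
have s3 : S (fun x y z => vtx x y z && (x * y - z == z)) =
          S (fun x y z => vtx x y z && (y * z - x == x)).
  rewrite sum3_swap23 -s2; do 3!apply: eq_bigr => ? _; by rewrite vtx23.
have s13 : S (fun x y z => [&& vtx x y z, y * z - x == x & x * y - z == z]) =
           S (fun x y z => [&& vtx x y z, y * z - x == x & x * z - y == y]).
  rewrite sum3_swap23; apply: eq_bigr => x _; apply: eq_bigr => y _.
  by apply: eq_bigr => z _; rewrite vtx23 [z * y]mulrC.
have s23 : S (fun x y z => [&& vtx x y z, x * z - y == y & x * y - z == z]) =
           S (fun x y z => [&& vtx x y z, y * z - x == x & x * z - y == y]).
  rewrite sum3_swap12 -s13; apply: eq_bigr => x _; apply: eq_bigr => y _.
  by apply: eq_bigr => z _; rewrite vtx12 [y * x]mulrC.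
rewrite card_sum_indicator sum_triple.
transitivity (\sum_(x : F) \sum_(y : F) \sum_(z : F)
  (n0 * (vtx x y z)%:Z
   + n1 * ((vtx x y z && (y * z - x == x))%:Z
           + (vtx x y z && (x * z - y == y))%:Z
           + (vtx x y z && (x * y - z == z))%:Z)
   + n2 * ([&& vtx x y z, y * z - x == x & x * z - y == y]%:Z
           + [&& vtx x y z, y * z - x == x & x * y - z == z]%:Z
           + [&& vtx x y z, x * z - y == y & x * y - z == z]%:Z)
   + n3 * [&& vtx x y z, y * z - x == x, x * z - y == y & x * y - z == z]%:Z)).
  do 3!(apply: eq_bigr => ? _); rewrite inE.
  case: (boolP (vtx _ _ _)) => [v|_] /=; last by rewrite !mulr0 !addr0.
  by rewrite vieta_degreeE // QE mulr1.
have split3 (f g : F -> F -> F -> int) :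
    \sum_(x : F) \sum_(y : F) \sum_(z : F) (f x y z + g x y z) =
    \sum_(x : F) \sum_(y : F) \sum_(z : F) f x y z +
    \sum_(x : F) \sum_(y : F) \sum_(z : F) g x y z.
  rewrite -big_split; apply: eq_bigr => x _; rewrite -big_split.
  by apply: eq_bigr => y _; rewrite -big_split.
have scale3 (n : int) (f : F -> F -> F -> int) :
    \sum_(x : F) \sum_(y : F) \sum_(z : F) (n * f x y z) =
    n * \sum_(x : F) \sum_(y : F) \sum_(z : F) f x y z.
  rewrite mulr_sumr; apply: eq_bigr => x _; rewrite mulr_sumr.
  by apply: eq_bigr => y _; rewrite mulr_sumr.
rewrite !(split3, scale3) s2 s3 s13 s23; ring.
Qed.

Lemma card_vieta_graph :
  let E : int := \sum_(t : F) s (t * (t - 4) * (t - D)) in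
  [/\ #|vieta_vertices D|%:Z = q ^+ 2 + 1 + (3 + s D) * s (D - 4) * q,
      #|vieta_deficient D|%:Z = 3 * (q - 4 - s D + E) + (D == 0)%:Z,
      #|vieta_degree_eq D 2|%:Z = 3 * (q - 5 - 2 * s D + E + (D == 0)%:Z),
      #|vieta_degree_eq D 1|%:Z = 3 * (1 + s D - (D == 0)%:Z)
    & #|vieta_degree_eq D 0|%:Z = (D == 0)%:Z].
Proof.
split.
- by rewrite card_vieta_vertices sum_vertices.
(* The coefficients here and below come from inclusion-exclusion: (1, -1, 1) for at least one fixed
   flip, (1, -2, 3) for exactly one, (0, 1, -3) for exactly two and (0, 0, 1) for all three. *)
- rewrite (card_vieta_degree_sym (fun d => d < 3)%N 0 1 (-1) 1); last by do 3!case.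
  rewrite sum_fixed1 sum_fixed12 sum_fixed123; ring.
- rewrite (card_vieta_degree_sym (fun d => d == 2)%N 0 1 (-2) 3); last by do 3!case.
  rewrite sum_fixed1 sum_fixed12 sum_fixed123; ring.
- rewrite (card_vieta_degree_sym (fun d => d == 1)%N 0 0 1 (-3)); last by do 3!case.
  rewrite sum_fixed12 sum_fixed123; ring.
- rewrite (card_vieta_degree_sym (fun d => d == 0)%N 0 0 0 1); last by do 3!case.
  rewrite sum_fixed123; ring.
Qed.

End FixedD.

(** * Evaluating the cubic sum for the special values of D *)

Lemma quadcharN_jacobsthal : s (-1) * jacobsthal2_1 F = jacobsthal2_1 F.
Proof.
case: (quadcharP (-1)) => [[/eqP]|[_ ->]|[_ sN1]].
- by rewrite oppr_eq0 oner_eq0.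
- by rewrite mul1r.
by rewrite /jacobsthal2_1 sum_quadchar_odd ?mulr0 // => x; ring.
Qed.

Lemma sum_quadchar_rescale_cube_sub (g : F -> F) (a b c : F) : a != 0 ->
  (forall r, g (a * r + b) = c * (r ^+ 3 - r)) ->
  \sum_(t : F) s (g t) = s c * s (-2) * jacobsthal2_1 F.
Proof.
move=> a0 gE; have bij : bijective (fun r => a * r + b).
  by exists (fun t => (t - b) / a) => x; field.
rewrite (reindex _ (onW_bij _ bij)) /= -mulrA -sum_quadchar_cube_sub mulr_sumr.
by apply: eq_bigr => r _; rewrite gE quadcharM.
Qed.

(** For D = 0 the cubic is t^2 (t - 4), so the square drops out for t != 0. What remains is the full
    sum of s(t - 4), which is zero, without its term s(-4) at t = 0. *)
Lemma sum_quadchar_cubic0 :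
  \sum_(t : F) s (t * (t - 4) * (t - 0)) = - s (-1).
Proof.
transitivity (\sum_(t : F) s (t - 4) - s (- 4)).
  rewrite (bigD1 0) //= [X in _ = X - _](bigD1 0) //= !mul0r quadchar0 add0r.
  rewrite [0 - 4]sub0r [RHS]addrC addKr; apply: eq_bigr => t t0.
  by rewrite -(quadcharMsq (t - 4) _ t0); congr s; ring.
have bij : bijective (fun t => t - 4 : F).
  by exists (fun t => t + 4) => x; rewrite ?addrK ?subrK.
have -> : \sum_(t : F) s (t - 4) = 0.
  by rewrite -[RHS]sum_quadchar [in RHS](reindex _ (onW_bij _ bij)).
rewrite sub0r (_ : -4 = 2 ^+ 2 * -1); last by ring.
by rewrite quadcharMsq.
Qed.

End QuadraticCharacter.

Theorem theorem13p3 (p : nat) (p_prime : prime p) (p_ge5 : (5 <= p)%N) :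
  let s (a : 'F_p) : int := quadchar a in
  let phi : int := jacobsthal2_1 'F_p in
  let nvert (D : 'F_p) : int := #|vieta_vertices D|%:Z in
  let ndef (D : 'F_p) : int := #|vieta_deficient D|%:Z in
  let ndeg (D : 'F_p) (d : nat) : int := #|vieta_degree_eq D d|%:Z in
  [/\ (* D = 0 *)
      [/\ nvert 0 = p%:Z ^+ 2 + 1 + 3 * s (-1) * p%:Z,
          ndef 0 = 3 * p%:Z - 11 - 3 * s (-1),
          ndeg 0 2%N = 3 * (p%:Z - 4 - s (-1)),
          ndeg 0 1%N = 0
        & ndeg 0 0%N = 1],
      (* D = -4 *)
      [/\ nvert (-4) = p%:Z ^+ 2 + 1 + (3 + s (-1)) * s (-2) * p%:Z,
          ndef (-4) = 3 * (p%:Z - 4 - s (-1) + s (-2) * phi),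
          ndeg (-4) 2%N = 3 * (p%:Z - 5 - 2 * s (-1) + s (-2) * phi),
          ndeg (-4) 1%N = 3 * (1 + s (-1))
        & ndeg (-4) 0%N = 0],
      (* D = 2 *)
      [/\ nvert 2 = p%:Z ^+ 2 + 1 + (3 + s 2) * s (-2) * p%:Z,
          ndef 2 = 3 * (p%:Z - 4 - s 2 + phi),
          ndeg 2 2%N = 3 * (p%:Z - 5 - 2 * s 2 + phi),
          ndeg 2 1%N = 3 * (1 + s 2)
        & ndeg 2 0%N = 0]
    & (* D = 8 *)
      [/\ nvert 8 = p%:Z ^+ 2 + 1 + (3 + s 2) * p%:Z,
          ndef 8 = 3 * (p%:Z - 4 - s 2 + s 2 * phi),
          ndeg 8 2%N = 3 * (p%:Z - 5 - 2 * s 2 + s 2 * phi),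
          ndeg 8 1%N = 3 * (1 + s 2)
        & ndeg 8 0%N = 0]].

Proof.
move=> s phi nvert ndef ndeg.
have two_neq0 : (2 : 'F_p) != 0.
  apply/negP => /eqP h2; have := dvdn_pcharf (pchar_Fp p_prime) 2.
  rewrite h2 eqxx => /esym; rewrite (dvdn_prime2 p_prime) //; lia.
have four_neq0 := four_neq0 _ two_neq0.
have eight : (8 : 'F_p) = 2 ^+ 2 * 2 by ring.
have s4 : quadchar (4 : 'F_p) = 1 by apply: quadchar4.
have sN4 : quadchar (-4 : 'F_p) = quadchar (-1 : 'F_p).
  by rewrite (_ : -4 = 2 ^+ 2 * -1) ?quadcharMsq //; ring.
have s8 : quadchar (8 : 'F_p) = quadchar (2 : 'F_p) by rewrite eight quadcharMsq.
have sN2 : quadchar (-2 : 'F_p) = quadchar (-1 : 'F_p) * quadchar (2 : 'F_p).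
  by rewrite -quadcharM // mulN1r.
have sN8 : quadchar (-8 : 'F_p) = quadchar (-2 : 'F_p).
  by rewrite (_ : -8 = 2 ^+ 2 * -2) ?quadcharMsq //; ring.
have phiN : quadchar (-1 : 'F_p) * phi = phi by apply: quadcharN_jacobsthal.
have s2s2 : quadchar (2 : 'F_p) * quadchar (2 : 'F_p) = 1 by apply: quadchar_mul_self.
have trueZ : true%:Z = 1 by [].
have falseZ : false%:Z = 0 by [].
have cardF : #|'F_p| = p by apply: card_Fp.
(* The roots are -4, 0, 4, and t = 4r turns the cubic into 64 (r^3 - r), where 64 is a square. *)
have N4 : \sum_(t : 'F_p) quadchar (t * (t - 4) * (t - -4)) = s (-2) * phi.
  rewrite (sum_quadchar_rescale_cube_sub _ two_neq0 _ 4 0 (4 ^+ 2 * 4)) //.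
    by rewrite quadcharMsq // s4 mul1r.
  by move=> r; ring.
(* The roots are 0, 2, 4, and t = 2r + 2 gives 8 (r^3 - r). The factor s(8) s(-2) equals s(-1),
   which [phiN] absorbs. *)
have E2 : \sum_(t : 'F_p) quadchar (t * (t - 4) * (t - 2)) = phi.
  rewrite (sum_quadchar_rescale_cube_sub _ two_neq0 _ 2 2 (2 ^+ 2 * 2)) //.
    by rewrite quadcharMsq // sN2 mulrCA s2s2 mulr1.
  by move=> r; ring.
(* The roots are 0, 4, 8, and t = 4r + 4 gives 64 (r^3 - r); [phiN] then replaces s(-2) by s(2). *)
have E8 : \sum_(t : 'F_p) quadchar (t * (t - 4) * (t - 8)) = s 2 * phi.
  rewrite (sum_quadchar_rescale_cube_sub _ two_neq0 _ 4 4 (4 ^+ 2 * 4)) //.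
    by rewrite quadcharMsq // s4 mul1r sN2 mulrAC mulrC phiN.
  by move=> r; ring.
split.
- have [] := card_vieta_graph _ two_neq0 0; first by rewrite eq_sym.
  rewrite sum_quadchar_cubic0 // cardF eqxx sub0r sN4 quadchar0 /nvert /ndef /ndeg.
  by move=> -> -> -> -> ->; split; rewrite /s ?trueZ ?falseZ; ring.
- have [] := card_vieta_graph _ two_neq0 (-4).
    by rewrite -subr_eq0 (_ : -4 - 4 = - (2 * 4)) ?oppr_eq0 ?mulf_neq0 //; ring.
  rewrite N4 cardF oppr_eq0 (negbTE four_neq0) sN4.
  rewrite (_ : -4 - 4 = -8); last by ring.
  rewrite sN8 /nvert /ndef /ndeg.
  by move=> -> -> -> -> ->; split; rewrite /s ?trueZ ?falseZ; ring.
- have [] := card_vieta_graph _ two_neq0 2.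
    by rewrite -subr_eq0 (_ : 2 - 4 = - 2) ?oppr_eq0 //; ring.
  rewrite E2 cardF (negbTE two_neq0) (_ : 2 - 4 = -2); last by ring.
  rewrite /nvert /ndef /ndeg.
  by move=> -> -> -> -> ->; split; rewrite /s ?trueZ ?falseZ; ring.
- have [] := card_vieta_graph _ two_neq0 8.
    by rewrite -subr_eq0 (_ : 8 - 4 = 4) //; ring.
  rewrite E8 cardF eight mulf_eq0 expf_eq0 /= (negbTE two_neq0) -eight.
  rewrite (_ : 8 - 4 = 4); last by ring.
  rewrite s4 s8 /nvert /ndef /ndeg.
  by move=> -> -> -> -> ->; split; rewrite /s ?trueZ ?falseZ; ring.
Qed.
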